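(* Let $(S,\|\cdot\|)$ be a complete $RN$ module over $K$ with base $(\Omega,\mathcal F,P)$, let $\{T(t):t\geq0\}$ be an a.s. bounded $C_{0}$--semigroup on $S$ and $(A,D(A))$ its infinitesimal generator. Then $A$ is a densely defined module homomorphism on $S$ and satisfies (a) $\frac{dT(t)x}{dt}=AT(t)x=T(t)Ax$ for any $x\in D(A)$ (and $t\ge 0$); (b) $T(r)x-x=\int_{0}^{r}T(s)Ax\,ds=\int_{0}^{r}AT(s)x\,ds$ for any $x\in D(A)$ and real $r>0$.
   Context: $(\Omega,\mathcal F,P)$ is a probability space; $L^{0}(\mathcal F,K)$ ($K=R$ or $C$) is the algebra of equivalence classes of $K$-valued $\mathcal F$-measurable random variables, ordered a.s.; $L^{0}_{+}(\mathcal F)=\{\xi\in L^0(\mathcal F,R):\xi\ge 0\}$. An $RN$ module over $K$ with base $(\Omega,\mathcal F,P)$ is a left $L^0(\mathcal F,K)$-module $S$ with a map $\|\cdot\|:S\to L^0_+(\mathcal F)$ such that $\|\xi x\|=|\xi|\|x\|$, $\|x+y\|\le\|x\|+\|y\|$, and $\|x\|=0$ implies $x=0$; it carries the $(\varepsilon,\lambda)$-topology, in which $x_n\to x$ iff $\|x_n-x\|\to0$ in probability; completeness, density, derivatives ($\frac{d}{dt}g(t)=\lim_{h\to0}\frac{g(t+h)-g(t)}{h}$) and Riemann integrals (limits of Riemann sums) of $S$-valued functions refer to this topology. $B(S)$ is the set of continuous module homomorphisms $S\to S$, with $\|T\|=\bigwedge\{\xi\in L^0_+(\mathcal F):\|Tx\|\le\xi\|x\|\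 \forall x\}$. A $C_0$--semigroup is $\{T(t):t\ge0\}\subset B(S)$ with $T(0)=I$, $T(s)T(t)=T(s+t)$, $\lim_{t\downarrow0}T(t)x=x$ for all $x$. It is a.s. bounded if there is a real $L>0$ with $\bigvee_{t\in[0,L]}\|T(t)\|\in L^0_+(\mathcal F)$. Its infinitesimal generator is $Ax=\lim_{t\downarrow0}\frac{T(t)x-x}{t}$ on $D(A)=\{x:\text{the limit exists}\}$. *)

(* Defs.v *)
From HB Require Import structures.
From mathcomp Require Import all_boot all_order all_algebra.
From mathcomp Require Import all_classical all_reals all_analysis.
From mathcomp Require Import complex.
Set Implicit Arguments. Unset Strict Implicit. Unset Printing Implicit Defensive.
Import Order.TTheory GRing.Theory Num.Theory.
Import numFieldNormedType.Exports.
Local Open Scope classical_set_scope.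
Local Open Scope ring_scope.

(* Scalars K.  K = R (isC = false) or K = C (isC = true); we realise both     *)
(* inside R[i] = complex R: K-valued random variables are functions          *)
(* Omega -> R[i] with measurable real and imaginary parts, whose imaginary   *)
(* part vanishes identically when K = R.  L^0(F,K) is the quotient of such   *)
(* functions by a.s. equality; we work with representatives and impose that  *)
(* every structure respects a.s. equality (setoid presentation).             *)

Notation Cx R := (complex.complex R).

Definition cRe {R : Type} (z : Cx R) : R := complex.Re z.
Definition cIm {R : Type} (z : Cx R) : R := complex.Im z.
Definition cabs {R : rcfType} (z : Cx R) : R := Num.sqrt (cRe z ^+ 2 + cIm z ^+ 2).
Definition cst_K {R : rcfType} (c : R) : Cx R := complex.Complex c 0.

Section RN.
Context {d : measure_display} {Omega : measurableType d} {R : realType}.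
Variable (P : probability Omega R).

Definition L0K (isC : bool) (xi : Omega -> Cx R) : Prop :=
  measurable_fun setT (fun w => cRe (xi w)) /\
  measurable_fun setT (fun w => cIm (xi w)) /\
  (~~ isC -> forall w, cIm (xi w) = 0).

Definition L0R (f : Omega -> R) : Prop := measurable_fun setT f.

Definition L0plus (f : Omega -> R) : Prop :=
  L0R f /\ {ae P, forall w, 0 <= f w}.

Definition ae_eqK (xi eta : Omega -> Cx R) : Prop := {ae P, forall w, xi w = eta w}.
Definition ae_le (f g : Omega -> R) : Prop := {ae P, forall w, f w <= g w}.

Definition is_L0_sup (E : set (Omega -> R)) (s : Omega -> R) : Prop :=
  L0R s /\ (forall f, E f -> ae_le f s) /\
  (forall u, L0R u -> (forall f, E f -> ae_le f u) -> ae_le s u).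
Definition is_L0_inf (E : set (Omega -> R)) (s : Omega -> R) : Prop :=
  L0R s /\ (forall f, E f -> ae_le s f) /\
  (forall u, L0R u -> (forall f, E f -> ae_le u f) -> ae_le u s).

Definition is_RN_module (isC : bool) (S : zmodType)
    (smul : (Omega -> Cx R) -> S -> S) (nrm : S -> Omega -> R) : Prop :=
  (forall xi eta x, L0K isC xi -> L0K isC eta -> ae_eqK xi eta -> smul xi x = smul eta x) /\
  (forall xi x y, L0K isC xi -> smul xi (x + y) = smul xi x + smul xi y) /\
  (forall xi eta x, L0K isC xi -> L0K isC eta ->
     smul (fun w => xi w + eta w) x = smul xi x + smul eta x) /\
  (forall xi eta x, L0K isC xi -> L0K isC eta ->
     smul (fun w => xi w * eta w) x = smul xi (smul eta x)) /\
  (forall x, smul (fun _ => 1) x = x) /\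
  (forall x, L0plus (nrm x)) /\
  (forall xi x, L0K isC xi ->
     {ae P, forall w, nrm (smul xi x) w = cabs (xi w) * nrm x w}) /\
  (forall x y, {ae P, forall w, nrm (x + y) w <= nrm x w + nrm y w}) /\
  (forall x, {ae P, forall w, nrm x w = 0} -> x = 0).

Definition rscal (S : Type) (smul : (Omega -> Cx R) -> S -> S) (c : R) (x : S) : S :=
  smul (fun _ => cst_K c) x.

(* y belongs to x + U(eps,lambda), U(eps,lambda) = {z : P{||z|| < eps} > 1 - lambda} *)
Definition el_near (S : zmodType) (nrm : S -> Omega -> R) (y x : S) (e l : R) : Prop :=
  ((1 - l)%:E < P [set w | (nrm (y - x)%R w < e)%R])%E.

Definition el_cvg (S : zmodType) (nrm : S -> Omega -> R) {U : Type}
    (F : set_system U) (g : U -> S) (x : S) : Prop :=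
  forall e l : R, 0 < e -> 0 < l -> \forall u \near F, el_near nrm (g u) x e l.

Definition el_cauchy (S : zmodType) (nrm : S -> Omega -> R) (u : nat -> S) : Prop :=
  forall e l : R, 0 < e -> 0 < l -> exists N, forall m n, (N <= m)%N -> (N <= n)%N ->
    el_near nrm (u n) (u m) e l.
Definition el_complete (S : zmodType) (nrm : S -> Omega -> R) : Prop :=
  forall u : nat -> S, el_cauchy nrm u -> exists x, el_cvg nrm (eventually : set_system nat) u x.

Definition el_continuous (S : zmodType) (nrm : S -> Omega -> R) (f : S -> S) : Prop :=
  forall x (e l : R), 0 < e -> 0 < l -> exists e' l' : R, 0 < e' /\ 0 < l' /\
    forall y, el_near nrm y x e' l' -> el_near nrm (f y) (f x) e l.

Definition el_dense (S : zmodType) (nrm : S -> Omega -> R) (D : set S) : Prop :=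
  forall x (e l : R), 0 < e -> 0 < l -> exists y, D y /\ el_near nrm y x e l.

Definition is_BS (isC : bool) (S : zmodType) (smul : (Omega -> Cx R) -> S -> S)
    (nrm : S -> Omega -> R) (f : S -> S) : Prop :=
  (forall x y, f (x + y) = f x + f y) /\
  (forall xi x, L0K isC xi -> f (smul xi x) = smul xi (f x)) /\
  el_continuous nrm f.

Definition is_opnorm (S : zmodType) (nrm : S -> Omega -> R) (f : S -> S)
    (nu : Omega -> R) : Prop :=
  is_L0_inf [set xi | L0plus xi /\ forall x, ae_le (nrm (f x)) (fun w => xi w * nrm x w)] nu.

Definition is_C0_semigroup (isC : bool) (S : zmodType) (smul : (Omega -> Cx R) -> S -> S)
    (nrm : S -> Omega -> R) (T : R -> S -> S) : Prop :=
  (forall t, 0 <= t -> is_BS isC smul nrm (T t)) /\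
  (forall x, T 0 x = x) /\
  (forall s t x, 0 <= s -> 0 <= t -> T s (T t x) = T (s + t) x) /\
  (forall x, el_cvg nrm (0 : R)^'+ (fun t => T t x) x).

Definition as_bounded (S : zmodType) (nrm : S -> Omega -> R) (T : R -> S -> S) : Prop :=
  exists L : R, 0 < L /\ exists nu : R -> Omega -> R,
    (forall t, 0 <= t <= L -> is_opnorm nrm (T t) (nu t)) /\
    exists s, L0plus s /\ is_L0_sup [set nu t | t in [set t | 0 <= t <= L]] s.

Definition is_generator (S : zmodType) (smul : (Omega -> Cx R) -> S -> S)
    (nrm : S -> Omega -> R) (T : R -> S -> S) (D : set S) (A : S -> S) : Prop :=
  (forall x, D x <-> exists y,
     el_cvg nrm (0 : R)^'+ (fun t => rscal smul t^-1 (T t x - x)) y) /\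
  (forall x, D x -> el_cvg nrm (0 : R)^'+ (fun t => rscal smul t^-1 (T t x - x)) (A x)).

(* derivative of g : R -> S at t >= 0 (one-sided at t = 0, since g is only   *)
(* considered on [0, +oo))                                                   *)
Definition el_has_derivative (S : zmodType) (smul : (Omega -> Cx R) -> S -> S)
    (nrm : S -> Omega -> R) (g : R -> S) (t : R) (v : S) : Prop :=
  el_cvg nrm (within [set h | 0 <= t + h] (0 : R)^')
    (fun h => rscal smul h^-1 (g (t + h) - g t)) v.

Definition tagged_partition (a b : R) (n : nat) (s tau : nat -> R) : Prop :=
  s 0%N = a /\ s n = b /\ (forall i, (i < n)%N -> s i < s i.+1) /\
  (forall i, (i < n)%N -> s i <= tau i <= s i.+1).

Definition mesh_lt (n : nat) (s : nat -> R) (delta : R) : Prop :=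
  forall i, (i < n)%N -> s i.+1 - s i < delta.

Definition riemann_sum (S : zmodType) (smul : (Omega -> Cx R) -> S -> S)
    (g : R -> S) (n : nat) (s tau : nat -> R) : S :=
  \sum_(i < n) rscal smul (s i.+1 - s i) (g (tau i)).

Definition el_riemann_integral (S : zmodType) (smul : (Omega -> Cx R) -> S -> S)
    (nrm : S -> Omega -> R) (g : R -> S) (a b : R) (I : S) : Prop :=
  forall e l : R, 0 < e -> 0 < l -> exists delta : R, 0 < delta /\
    forall n s tau, tagged_partition a b n s tau -> mesh_lt n s delta ->
      el_near nrm (riemann_sum smul g n s tau) I e l.

End RN.

(* Main.v *)
(* Put rho(f) = E min(|f|, 1), so that x |-> rho(||x||) is a translation
   invariant metric inducing the (eps, lambda)-topology.  If finitely many
   vectors z_i are uniformly small for it and share one a.s. bound C in L^0, then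
   so are their sums with weights of bounded total mass: outside the event
   {C > K}, min(|f|, 1) <= K sum_i w_i min(||z_i||, 1).  On [0, r] the semigroup has a
   common random bound M, so this controls the oscillation of Riemann sums of
   orbits.  For x in D(A), telescoping along equidistant points shows that
   T(r)x - x is a limit of sums of norm at most r M ||Ax||, i.e. the orbit is
   L^0-Lipschitz.  The difference quotients are therefore a.s. dominated, and the
   control of weighted sums gives convergence of the Riemann sums over arbitrary
   partitions.  Density comes from the limits of the averages of T(ih/n)x over i < n,
   that is, from h^-1 times the integral of T(s)x over [0, h]. *)

Require Import Defs.
From HB Require Import structures.
From mathcomp Require Import all_boot all_order all_algebra.
From mathcomp Require Import all_classical all_reals all_analysis.
From mathcomp Require Import measurable_realfun complex ring lra.
Import Order.TTheory GRing.Theory Num.Theory.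
Import numFieldNormedType.Exports.
Set Implicit Arguments.
Unset Strict Implicit.
Unset Printing Implicit Defensive.
Local Open Scope classical_set_scope.
Local Open Scope ring_scope.

(** * Truncated expectation and its tail estimate *)

Section TruncatedExpectation.
Context {d : measure_display} {Omega : measurableType d} {R : realType}.
Context (P : probability Omega R).
Implicit Types (f g C : Omega -> R).

Definition cut1 f (w : Omega) : R := Num.min `|f w| 1.

Lemma cut1_ge0 f w : 0 <= cut1 f w.
Proof. by rewrite /cut1 le_min normr_ge0 ler01. Qed.

Lemma cut1_le1 f w : cut1 f w <= 1.
Proof. by rewrite /cut1 ge_min lexx orbT. Qed.

Lemma measurable_cut1 f : L0R f -> L0R (cut1 f).
Proof.
move=> mf; apply: measurable_minr => //.
by apply: measurableT_comp => //; exact: normr_measurable.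
Qed.

Let measurable_E f : L0R f -> measurable_fun setT (fun w => (f w)%:E).
Proof. by move=> mf; apply/measurable_EFinP. Qed.

(** The truncation keeps the integral at most 1, so [fine] discards nothing when [f] is measurable;
    [rho_fin] records this. *)
Definition rho f : R := fine (\int[P]_w (cut1 f w)%:E).

Lemma rho_fin f : L0R f -> (\int[P]_w (cut1 f w)%:E)%E = (rho f)%:E.
Proof.
move=> mf; rewrite /rho fineK// ge0_fin_numE; last first.
  by apply: integral_ge0 => w _; rewrite lee_fin cut1_ge0.
apply: (@le_lt_trans _ _ (\int[P]_w (cst 1%:E w))%E); last first.
  by rewrite integral_cst// [X in (_ * X)%E]probability_setT mule1 ltry.
apply: ge0_le_integral => //.
- by move=> w _; rewrite lee_fin cut1_ge0.
- exact/measurable_E/measurable_cut1.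
- by move=> w _; rewrite lee_fin cut1_le1.
Qed.

Lemma rho_ge0 f : 0 <= rho f.
Proof.
by apply: fine_ge0; apply: integral_ge0 => w _; rewrite lee_fin cut1_ge0.
Qed.

Lemma measurable_gt C K : L0R C -> measurable [set w | K < C w].
Proof.
move=> mC.
have := measurable_fun_ltr (measurable_cst K) mC measurableT (Y := [set true]).
rewrite setTI => /(_ I); congr measurable.
Qed.

Lemma measurable_lt f (e : R) : L0R f -> measurable [set w | f w < e].
Proof.
move=> mf; have := measurable_gt (- e) (C := fun w => - f w).
rewrite (_ : [set w | _] = [set w | f w < e]); last first.
  by apply/seteqP; split=> w /=; rewrite ltrN2.
by apply; exact: measurableT_comp.
Qed.

(* The a.s. bound on the truncations holds off the event [K < C], which has
   small probability once [K] is large. *)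
Lemma rho_le_tail n f C (K : R) (wt : nat -> R) (phi : nat -> Omega -> R) :
  L0R f -> L0R C -> (forall i, L0R (phi i)) -> (forall i, (i < n)%N -> 0 <= wt i) ->
  {ae P, forall w, C w <= K -> cut1 f w <= \sum_(i < n) wt i * cut1 (phi i) w} ->
  ((rho f)%:E <= P [set w | (K < C w)%R] + (\sum_(i < n) wt i * rho (phi i))%:E)%E.
Proof.
move=> mf mC mphi wt0 H; set A := [set w | _].
have mA : measurable A by exact: measurable_gt.
have mc i : L0R (fun w => wt i * cut1 (phi i) w).
  by apply: measurable_funM => //; exact: measurable_cut1.
have -> : P A = (\int[P]_w (\1_A w)%:E)%E by rewrite integral_indic// setIT.
have -> : ((\sum_(i < n) wt i * rho (phi i))%:E =
           \int[P]_w (\sum_(i < n) (wt i * cut1 (phi i) w)%:E))%E.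
  pose F (i : nat) (w : Omega) : \bar R :=
    if (i < n)%N then (wt i * cut1 (phi i) w)%:E else 0%E.
  transitivity (\int[P]_w (\sum_(i < n) F i w))%E; last first.
    by apply: eq_integral => w _; apply: eq_bigr => i _; rewrite /F ltn_ord.
  rewrite (@ge0_integral_sum _ _ _ P setT measurableT _ (fun i : 'I_n => F i)).
  - rewrite -sumEFin; apply: eq_bigr => i _.
    rewrite /F ltn_ord; under eq_integral do rewrite EFinM.
    rewrite ge0_integralZl_EFin//.
    + by rewrite rho_fin.
    + by move=> w _; rewrite lee_fin cut1_ge0.
    + exact/measurable_E/measurable_cut1.
    + exact: wt0.
  - by move=> i; rewrite /F ltn_ord; exact/measurable_E.
  - move=> i w _; rewrite /F ltn_ord lee_fin mulr_ge0 ?cut1_ge0//; exact: wt0.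
have ms : measurable_fun setT (fun w => \sum_(i < n) (wt i * cut1 (phi i) w)%:E)%E.
  by apply: emeasurable_sum => i; exact/measurable_E.
have s0 w : (0 <= \sum_(i < n) (wt i * cut1 (phi i) w)%:E)%E.
  by apply: sume_ge0 => i _; rewrite lee_fin mulr_ge0 ?cut1_ge0// wt0.
have mi : measurable_fun setT (fun w => (\1_A w)%:E : \bar R).
  by apply: measurable_E; exact: measurable_indic.
rewrite -ge0_integralD// -rho_fin//.
apply: ae_ge0_le_integral => //.
- by move=> w _; rewrite lee_fin cut1_ge0.
- exact/measurable_E/measurable_cut1.
- by move=> w _; rewrite adde_ge0// lee_fin.
- exact: emeasurable_funD.
apply: filterS H => w H _.
have [CK|KC] := leP (C w) K.
  rewrite (le_trans _ (leeDr _ _))// ?lee_fin//.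
  by rewrite sumEFin lee_fin H.
rewrite (le_trans _ (leeDl _ _))//.
by rewrite lee_fin indicE mem_set// cut1_le1.
Qed.

(** Since [C] is real-valued, the decreasing events where [C] exceeds [n.+1] have empty
    intersection, and continuity from above of [P] applies. *)
Lemma tail_small C (e : R) : L0R C -> 0 < e ->
  exists2 K : R, 1 <= K & (P [set w | (K < C w)%R] < e%:E)%E.
Proof.
move=> mC e0; pose F (n : nat) := [set w | n.+1%:R < C w].
have mF n : measurable (F n) by exact: measurable_gt.
have F0 : \bigcap_n F n = set0.
  rewrite -subset0 => w /= H.
  have := H (Num.truncn `|C w|) I; rewrite /F /= ltNge => /negP; apply.
  have /andP[_ /ltW] := truncn_itv (normr_ge0 (C w)).
  by apply: le_trans; exact: ler_norm.
have : (P \o F) n @[n --> \oo] --> P (\bigcap_n F n).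
  apply: nonincreasing_cvg_mu => //.
  - by rewrite (le_lt_trans (probability_le1 _ _))// ltry.
  - by rewrite F0.
  - move=> m n mn; apply/subsetPset => w /=; apply: le_lt_trans.
    by rewrite ler_nat ltnS.
rewrite F0 measure0 => /fine_cvgP[_] /cvgrPdist_lt /(_ _ e0).
case=> n _ /(_ n (leqnn n)) /=.
rewrite sub0r normrN ger0_norm ?fine_ge0// => H.
exists n.+1%:R; first by rewrite ler1n.
rewrite -(@fineK _ (P (F n))) ?lte_fin//; exact: fin_num_measure.
Qed.
End TruncatedExpectation.

(** * Subadditivity of [rho], comparison with convergence in probability, and uniform smallness *)

Section TruncatedExpectationBounds.
Context {d : measure_display} {Omega : measurableType d} {R : realType}.
Context (P : probability Omega R).
Implicit Types (f g C : Omega -> R).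

(** The tail estimate with [C = 0] and [K = 1]: the exceptional event is empty. *)
Lemma rho_le_sum n f (phi : nat -> Omega -> R) :
  L0R f -> (forall i, L0R (phi i)) ->
  {ae P, forall w, cut1 f w <= \sum_(i < n) cut1 (phi i) w} ->
  rho P f <= \sum_(i < n) rho P (phi i).
Proof.
move=> mf mphi H.
have m0 : L0R (cst 0 : Omega -> R) by exact: measurable_cst.
have := @rho_le_tail _ _ _ P n f (cst 0) 1 (fun=> 1) phi mf m0 mphi (fun _ _ => ler01).
have -> : [set w | 1 < cst 0 w :> R] = set0 :> set Omega.
  by rewrite -subset0 => w /=; rewrite ltr10.
rewrite measure0 add0e lee_fin.
under eq_bigr do rewrite mul1r; apply.
by apply: filterS H => w H _; under eq_bigr do rewrite mul1r.
Qed.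

Lemma le_rho f g : L0R f -> L0R g ->
  {ae P, forall w, `|f w| <= `|g w|} -> rho P f <= rho P g.
Proof.
move=> mf mg H; have := @rho_le_sum 1 f (fun=> g) mf (fun=> mg).
rewrite big_ord1; apply; apply: filterS H => w H.
by rewrite big_ord1 /cut1 le_min2.
Qed.

Lemma rho_triangle f g h : L0R f -> L0R g -> L0R h ->
  {ae P, forall w, `|f w| <= `|g w| + `|h w|} -> rho P f <= rho P g + rho P h.
Proof.
move=> mf mg mh H.
have := @rho_le_sum 2 f (fun i => if i is 0%N then g else h) mf.
rewrite !big_ord_recl !big_ord0 /= addr0; apply.
  by case.
apply: filterS H => w H; rewrite !big_ord_recl !big_ord0 /= addr0 /cut1.
have := normr_ge0 (g w); have := normr_ge0 (h w); move: H.
by rewrite /Order.min; do 3 case: ifP; move=> *; lra.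
Qed.

Lemma rho_cst_le (c : R) : rho P (cst c : Omega -> R) <= `|c|.
Proof.
have m0 : L0R (cst c : Omega -> R) by exact: measurable_cst.
rewrite -lee_fin -rho_fin// (le_trans (y := \int[P]_w (cst `|c|%:E w))%E)//.
  apply: ge0_le_integral => //.
  - by move=> w _; rewrite lee_fin cut1_ge0.
  - by apply/measurable_EFinP; exact: measurable_cut1.
  - by move=> w _; rewrite lee_fin /cut1 ge_min lexx.
by rewrite integral_cst// [X in (_ * X)%E]probability_setT mule1.
Qed.

Lemma rho_eq0 f : L0R f -> rho P f = 0 -> {ae P, forall w, f w = 0}.
Proof.
move=> mf f0.
have mc : measurable_fun setT (fun w => (cut1 f w)%:E).
  by apply/measurable_EFinP; exact: measurable_cut1.
have : (\int[P]_w `|(cut1 f w)%:E| = 0)%E.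
  under eq_integral => w _ do rewrite gee0_abs ?lee_fin ?cut1_ge0//.
  by rewrite rho_fin// f0.
move/(ae_eq_integral_abs P measurableT mc).
apply: filterS => w /(_ I) [] /=; rewrite /cut1 /Order.min.
by case: ifP => [_ /eqP|_ /eqP]; rewrite ?normr_eq0 ?oner_eq0// => /eqP.
Qed.

(** Markov's inequality: where [|f|] is at least [e], so is its truncation, because [e <= 1]. *)
Lemma near_of_rho f (e l : R) : L0R f -> 0 < e -> e <= 1 -> rho P f < e * l ->
  ((1 - l)%:E < P [set w | (f w < e)%R])%E.
Proof.
move=> mf e0 e1 H.
have mA : measurable [set w | `|f w| < e].
  by apply: measurable_lt; exact: measurableT_comp.
have mB : measurable [set w | f w < e] by exact: measurable_lt.
apply: (@lt_le_trans _ _ (P [set w | (`|f w| < e)%R])); last first.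
  apply: le_measure; rewrite ?inE//.
  by move=> w /=; apply: le_lt_trans; exact: ler_norm.
set A := [set w | _] in mA *.
have PA : P A = (fine (P A))%:E by rewrite fineK// fin_num_measure.
have PC : P (~` A) = (\int[P]_w (\1_(~` A) w)%:E)%E.
  by rewrite integral_indic ?setIT//; exact: measurableC.
have : (e%:E * P (~` A) <= (rho P f)%:E)%E.
  rewrite -rho_fin// PC.
  rewrite -ge0_integralZl_EFin//; last 2 first.
  - by apply/measurable_EFinP; apply: measurable_indic; exact: measurableC.
  - exact: ltW.
  apply: ge0_le_integral => //.
  - by move=> w _; rewrite -EFinM lee_fin mulr_ge0// ltW.
  - apply/measurable_EFinP; apply: measurable_funM => //.
    by apply: measurable_indic; exact: measurableC.
  - by apply/measurable_EFinP; exact: measurable_cut1.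
  - move=> w _; rewrite -EFinM lee_fin indicE.
    have [|] := boolP (w \in ~` A); last by rewrite mulr0 cut1_ge0.
    by rewrite inE /A /= => /negP; rewrite -leNgt mulr1 /cut1 le_min e1 andbT.
rewrite probability_setC// PA -EFinB -EFinM lee_fin lte_fin => H2.
have : e * (1 - fine (P A)) < e * l by exact: le_lt_trans H.
rewrite ltr_pM2l//; lra.
Qed.

(** The truncation of [f] is dominated by that of the constant [e] plus the indicator of the event
    where [f] is at least [e], whose probability is below [l]. *)
Lemma rho_le_near f (e l : R) : L0R f -> 0 < e -> {ae P, forall w, 0 <= f w} ->
  ((1 - l)%:E < P [set w | (f w < e)%R])%E -> rho P f < e + l.
Proof.
move=> mf e0 f0 H.
have mB : measurable [set w | f w < e] by exact: measurable_lt.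
set A := [set w | _] in mB H.
have mI : L0R (\1_(~` A) : Omega -> R).
  by apply: measurable_indic; exact: measurableC.
have PA : P A = (fine (P A))%:E by rewrite fineK// fin_num_measure.
have PC : P (~` A) = (\int[P]_w (\1_(~` A) w)%:E)%E.
  by rewrite integral_indic ?setIT//; exact: measurableC.
have mc : L0R (cst e : Omega -> R) by exact: measurable_cst.
have : rho P f <= rho P (cst e) + rho P (\1_(~` A)).
  have := @rho_le_sum 2 f (fun i => if i is 0%N then cst e else \1_(~` A)) mf.
  rewrite !big_ord_recl !big_ord0 /= addr0; apply; first by case.
  apply: filterS f0 => w f0; rewrite !big_ord_recl !big_ord0 /= addr0 {3}/cut1 indicE.
  have [_|] := boolP (w \in ~` A).
    by rewrite normr1 minxx (le_trans (cut1_le1 _ _))// lerDr cut1_ge0.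
  rewrite notin_setE /A /= => /contrapT few.
  rewrite normr0 /cut1 (ger0_norm f0) (ger0_norm (ltW e0)).
  by rewrite [X in _ + X]min_l// addr0 le_min2// ltW.
have : rho P (\1_(~` A)) <= 1 - fine (P A).
  rewrite -lee_fin -rho_fin// EFinB -PA -probability_setC//.
  rewrite PC.
  apply: ge0_le_integral => //.
  - by move=> w _; rewrite lee_fin cut1_ge0.
  - by apply/measurable_EFinP; exact: measurable_cut1.
  - exact/measurable_EFinP.
  - by move=> w _; rewrite lee_fin /cut1 ge_min ger0_norm ?lexx.
move: H; rewrite PA lte_fin.
have := rho_cst_le e; rewrite gtr0_norm//; lra.
Qed.

(** Subadditivity alone would degrade as [n] grows. Off an event of probability below [e / 2] the
    common bound [C] is at most some [K >= 1], hence [|phi i|] is at most [K] times its truncation,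
    and only the total weight enters. *)
Lemma rho_sum_small C (W e : R) : L0R C -> 0 < e -> exists2 del : R, 0 < del &
  forall n f (wt : nat -> R) (phi : nat -> Omega -> R),
  L0R f -> (forall i, L0R (phi i)) ->
  (forall i, (i < n)%N -> 0 <= wt i) -> \sum_(i < n) wt i <= W ->
  (forall i, (i < n)%N -> {ae P, forall w, `|phi i w| <= C w}) ->
  {ae P, forall w, `|f w| <= \sum_(i < n) wt i * `|phi i w|} ->
  (forall i, (i < n)%N -> rho P (phi i) < del) ->
  rho P f < e.
Proof.
move=> mC e0.
have [K K1 HK] := tail_small P mC (divr_gt0 e0 (ltr0n _ 2)).
have W0 : 0 < 1 + `|W| by rewrite ltr_pwDl.
have K0 : 0 < K by lra.
(* Using [1 + |W|] instead of [W] keeps the denominator positive for every real [W]. *)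
exists (e / 2 / (K * (1 + `|W|))).
  by rewrite !divr_gt0// mulr_gt0.
set del := e / 2 / _ => n f wt phi mf mphi wt0 wtW bd Hf small.
have dK : K * (1 + `|W|) * del = e / 2.
  by rewrite /del mulrC divfK// mulf_neq0// gt_eqF.
have del0 : 0 < del by rewrite !divr_gt0// mulr_gt0.
have : ((rho P f)%:E <= P [set w | (K < C w)%R] +
        (\sum_(i < n) (wt i * K) * rho P (phi i))%:E)%E.
  apply: (@rho_le_tail _ _ _ P n f C K (fun i => wt i * K) phi) => //.
    by move=> i ni; rewrite mulr_ge0 ?wt0// ltW.
  have bd' : {ae P, forall w, forall i : 'I_n, `|phi i w| <= C w}.
    by apply: filter_forall => i; exact: bd.
  apply: filterS2 Hf bd' => w Hf bd' CK.
  rewrite (le_trans (y := `|f w|))// ?ge_min ?lexx// (le_trans Hf)//.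
  apply: ler_sum => i _; rewrite -mulrA ler_wpM2l ?wt0//.
  rewrite /cut1 /Order.min; case: ifP => _; last by rewrite mulr1 (le_trans (bd' i)).
  by rewrite ler_peMl.
have : \sum_(i < n) (wt i * K) * rho P (phi i) <= e / 2.
  rewrite -dK (le_trans (y := \sum_(i < n) wt i * (K * del)))//.
    apply: ler_sum => i _; rewrite -mulrA ler_wpM2l ?wt0// ler_wpM2l// ltW//.
    exact: small.
  rewrite -mulr_suml [leRHS](_ : _ = (1 + `|W|) * (K * del)); last by ring.
  apply: ler_wpM2r; first by rewrite mulr_ge0 ?ltW.
  by apply: (le_trans wtW); rewrite (le_trans (ler_norm _))// lerDr.
move=> s1 s2; rewrite -lte_fin (le_lt_trans s2)//.
apply: (@lt_le_trans _ _ ((e / 2)%:E + (e / 2)%:E)%E); last first.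
  by rewrite -EFinD lee_fin -splitr.
by rewrite lte_leD// ?lee_fin// fin_num_measure// ; exact: measurable_gt.
Qed.

(** Continuity at 0 of multiplication by a fixed random factor: that factor is cut at a level [K]
    exceeded with probability below [e / 2]. *)
Lemma rho_mul_small C (e : R) : L0R C -> 0 < e -> exists2 del : R, 0 < del &
  forall f g, L0R f -> L0R g -> {ae P, forall w, `|f w| <= C w * `|g w|} ->
  rho P g < del -> rho P f < e.
Proof.
move=> mC e0.
have [K K1 HK] := tail_small P mC (divr_gt0 e0 (ltr0n _ 2)).
have K0 : 0 < K by lra.
exists (e / 2 / K); first by rewrite !divr_gt0.
move=> f g mf mg H small.
have : ((rho P f)%:E <= P [set w | (K < C w)%R] +
        (\sum_(i < 1) K * rho P g)%:E)%E.
  apply: (@rho_le_tail _ _ _ P 1 f C K (fun=> K) (fun=> g)) => //.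
    by move=> *; exact: ltW.
  apply: filterS H => w H CK; rewrite big_ord1.
  have : `|f w| <= K * `|g w| by rewrite (le_trans H)// ler_wpM2r.
  rewrite /cut1 /Order.min; do 2 case: ifP; move=> *; lra.
rewrite big_ord1 => s; rewrite -lte_fin (le_lt_trans s)//.
rewrite [ltRHS](_ : _ = ((e / 2)%:E + (e / 2)%:E)%E); last by rewrite -EFinD -splitr.
rewrite lteD// lte_fin; move: small; rewrite ltr_pdivlMr//; lra.
Qed.
End TruncatedExpectationBounds.

Definition pnrm {d : measure_display} {Omega : measurableType d} {R : realType}
  (P : probability Omega R) {S : zmodType} (nrm : S -> Omega -> R) (x : S) : R :=
  rho P (nrm x).

(** * Module arithmetic and the translation-invariant metric of the
    $(\varepsilon,\lambda)$-topology *)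

Section RNModule.
Context {d : measure_display} {Omega : measurableType d} {R : realType}.
Context {P : probability Omega R} {isC : bool} {S : zmodType}.
Context {smul : (Omega -> Cx R) -> S -> S} {nrm : S -> Omega -> R}.
Context (HS : is_RN_module P isC smul nrm).

Local Notation "c ** x" := (rscal smul c x) (at level 40).

Lemma L0K_cst (c : R) : L0K isC (fun _ : Omega => cst_K c).
Proof. by split; [|split] => //; exact: measurable_cst. Qed.

Lemma smulDr xi x y : L0K isC xi -> smul xi (x + y) = smul xi x + smul xi y.
Proof. by case: HS => _ [H _]; exact: H. Qed.

Lemma smul0 xi : L0K isC xi -> smul xi 0 = 0.
Proof. by move=> h; apply: (addrI (smul xi 0)); rewrite -smulDr// !addr0. Qed.

Lemma smulN xi x : L0K isC xi -> smul xi (- x) = - smul xi x.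
Proof.
by move=> h; apply: (addrI (smul xi x)); rewrite -smulDr// !subrr smul0.
Qed.

Lemma smulBr xi x y : L0K isC xi -> smul xi (x - y) = smul xi x - smul xi y.
Proof. by move=> h; rewrite smulDr// smulN. Qed.

Lemma rscal_smulC c xi x : L0K isC xi -> c ** smul xi x = smul xi (c ** x).
Proof.
case: HS => _ [_ [_ [H _]]] h; rewrite /rscal -!H//; [|exact: L0K_cst..].
by congr smul; apply/funext => w; rewrite mulrC.
Qed.

Lemma rscalDr c x y : c ** (x + y) = c ** x + c ** y.
Proof. by apply: smulDr; exact: L0K_cst. Qed.

Lemma rscal0 c : c ** 0 = 0.
Proof. by apply: smul0; exact: L0K_cst. Qed.

Lemma rscalN c x : c ** (- x) = - (c ** x).
Proof. by apply: smulN; exact: L0K_cst. Qed.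

Lemma rscalBr c x y : c ** (x - y) = c ** x - c ** y.
Proof. by rewrite rscalDr rscalN. Qed.

Lemma rscalDl a b x : (a + b) ** x = a ** x + b ** x.
Proof.
case: HS => _ [_ [H _]]; rewrite /rscal -H; [|exact: L0K_cst..].
by congr smul; apply/funext => w; apply/eqP; rewrite eq_complex /= addr0 !eqxx.
Qed.

Lemma rscalA a b x : a ** (b ** x) = (a * b) ** x.
Proof.
case: HS => _ [_ [_ [H _]]]; rewrite /rscal -H; [|exact: L0K_cst..].
congr smul; apply/funext => w; apply/eqP.
by rewrite eq_complex /= !(mulr0, mul0r) subr0 addr0 !eqxx.
Qed.

Lemma rscal1 x : 1 ** x = x.
Proof. by case: HS => _ [_ [_ [_ [H _]]]]; exact: H. Qed.

Lemma rscal0l x : 0 ** x = 0.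
Proof. by apply: (addrI (0 ** x)); rewrite -rscalDl !addr0. Qed.

Lemma rscalNl a x : (- a) ** x = - (a ** x).
Proof. by apply: (addrI (a ** x)); rewrite -rscalDl !subrr rscal0l. Qed.

Lemma rscalBl a b x : (a - b) ** x = a ** x - b ** x.
Proof. by rewrite rscalDl rscalNl. Qed.

Lemma rscal_sumr c n (z : nat -> S) :
  c ** (\sum_(i < n) z i) = \sum_(i < n) c ** z i.
Proof. exact: (big_morph (rscal smul c) (rscalDr c) (rscal0 c)). Qed.

Lemma rscal_suml n (c : nat -> R) x :
  (\sum_(i < n) c i) ** x = \sum_(i < n) c i ** x.
Proof.
exact: (big_morph (fun a => a ** x) (fun a b => rscalDl a b x) (rscal0l x)).
Qed.

Lemma nrm_meas x : L0R (nrm x).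
Proof. by case: HS => _ [_ [_ [_ [_ [H _]]]]]; case: (H x). Qed.
#[local] Hint Resolve nrm_meas : core.

Lemma nrm_ge0 x : {ae P, forall w, 0 <= nrm x w}.
Proof. by case: HS => _ [_ [_ [_ [_ [H _]]]]]; case: (H x). Qed.

Lemma nrm_smul xi x : L0K isC xi ->
  {ae P, forall w, nrm (smul xi x) w = cabs (xi w) * nrm x w}.
Proof. by case: HS => _ [_ [_ [_ [_ [_ [H _]]]]]]; exact: H. Qed.

Lemma nrm_rscal c x : {ae P, forall w, nrm (c ** x) w = `|c| * nrm x w}.
Proof.
apply: filterS (nrm_smul x (L0K_cst c)) => w ->.
by rewrite /cabs /= expr0n addr0 sqrtr_sqr.
Qed.

Lemma nrmD x y : {ae P, forall w, nrm (x + y) w <= nrm x w + nrm y w}.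
Proof. by case: HS => _ [_ [_ [_ [_ [_ [_ [H _]]]]]]]; exact: H. Qed.

Lemma nrmN x : {ae P, forall w, nrm (- x) w = nrm x w}.
Proof.
apply: filterS (nrm_rscal (- 1) x) => w.
by rewrite rscalNl rscal1 normrN1 mul1r.
Qed.

Lemma nrmB x y : {ae P, forall w, nrm (x - y) w <= nrm x w + nrm y w}.
Proof. by apply: filterS2 (nrmD x (- y)) (nrmN y) => w + <-. Qed.

Lemma nrm0 : {ae P, forall w, nrm 0 w = 0}.
Proof.
by apply: filterS (nrm_rscal 0 0) => w; rewrite rscal0 normr0 mul0r.
Qed.

Lemma nrm_sum n (wt : nat -> R) (z : nat -> S) :
  {ae P, forall w, nrm (\sum_(i < n) wt i ** z i) w
                   <= \sum_(i < n) `|wt i| * nrm (z i) w}.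
Proof.
elim: n => [|n IH].
  by apply: filterS nrm0 => w w0; rewrite !big_ord0 w0.
have := nrmD (\sum_(i < n) wt i ** z i) (wt n ** z n).
apply: filterS3 IH (nrm_rscal (wt n) (z n)) => w IH E H.
by rewrite !big_ord_recr /= (le_trans H)// E lerD2r.
Qed.

Local Notation N := (pnrm P nrm).

Lemma pnrm_ge0 x : 0 <= N x. Proof. exact: rho_ge0. Qed.

Lemma pnrm_le x y : {ae P, forall w, nrm x w <= nrm y w} -> N x <= N y.
Proof.
move=> H; apply: le_rho => //.
by apply: filterS3 H (nrm_ge0 x) (nrm_ge0 y) => w H x0 y0; rewrite !ger0_norm.
Qed.

Lemma pnrmN x : N (- x) = N x.
Proof.
apply/eqP; rewrite eq_le; apply/andP; split; apply: pnrm_le;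
  by apply: filterS (nrmN x) => w ->.
Qed.

Lemma pnrm_distC x y : N (x - y) = N (y - x).
Proof. by rewrite -pnrmN opprB. Qed.

Lemma pnrmD x y : N (x + y) <= N x + N y.
Proof.
apply: rho_triangle => //.
have xy0 : {ae P, forall w, 0 <= nrm x w /\ 0 <= nrm y w}.
  by apply: filterS2 (nrm_ge0 x) (nrm_ge0 y) => w a b; split.
apply: filterS3 xy0 (nrmD x y) (nrm_ge0 (x + y)) => w [a b] H c.
by rewrite !ger0_norm.
Qed.

Lemma pnrm_triangle z x y : N (x - y) <= N (x - z) + N (z - y).
Proof. by rewrite -[x - y](subrKA z) pnrmD. Qed.

Lemma pnrm_eq0 x : N x = 0 -> x = 0.
Proof.
move=> /(rho_eq0 (nrm_meas x)).
by case: HS => _ [_ [_ [_ [_ [_ [_ [_ H]]]]]]]; exact: H.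
Qed.

Lemma pnrm_small0 x : (forall e : R, 0 < e -> N x < e) -> x = 0.
Proof.
move=> H; apply: pnrm_eq0; apply/eqP; rewrite eq_le pnrm_ge0 andbT.
by rewrite leNgt; apply/negP => /H; rewrite ltxx.
Qed.

Lemma pnrm_mul_small C (e : R) : L0R C -> 0 < e -> exists2 del : R, 0 < del &
  forall x y, {ae P, forall w, nrm x w <= C w * nrm y w} -> N y < del -> N x < e.
Proof.
move=> mC e0; have [del del0 H] := rho_mul_small P mC e0.
exists del => // x y xy; apply: H => //.
by apply: filterS3 xy (nrm_ge0 x) (nrm_ge0 y) => w H x0 y0; rewrite !ger0_norm.
Qed.

Lemma pnrm_sum_small C (W e : R) : L0R C -> 0 < e -> exists2 del : R, 0 < del &
  forall n (wt : nat -> R) (z : nat -> S),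
  (forall i, (i < n)%N -> 0 <= wt i) -> \sum_(i < n) wt i <= W ->
  (forall i, (i < n)%N -> {ae P, forall w, nrm (z i) w <= C w}) ->
  (forall i, (i < n)%N -> N (z i) < del) ->
  N (\sum_(i < n) wt i ** z i) < e.
Proof.
move=> mC e0; have [del del0 H] := rho_sum_small P W mC e0.
exists del => // n wt z wt0 wtW zC zdel.
apply: (H n _ wt (fun i => nrm (z i))) => //.
  move=> i ni; apply: filterS2 (zC i ni) (nrm_ge0 (z i)) => w ? ?.
  by rewrite ger0_norm.
have z0 : {ae P, forall w, forall i : 'I_n, 0 <= nrm (z i) w}.
  by apply: filter_forall => i; exact: nrm_ge0.
apply: filterS3 z0 (nrm_sum n wt z) (nrm_ge0 (\sum_(i < n) wt i ** z i)).
move=> w z0 H1 H2; rewrite ger0_norm// (le_trans H1)//.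
by apply: ler_sum => i _; rewrite !ger0_norm// wt0.
Qed.

Lemma pnrm0 : N 0 = 0.
Proof.
apply/eqP; rewrite eq_le pnrm_ge0 andbT.
have m0 : L0R (cst 0 : Omega -> R) by exact: measurable_cst.
have := rho_cst_le P (0 : R); rewrite normr0; apply: le_trans.
apply: le_rho => //.
by apply: filterS nrm0 => w ->.
Qed.

(** The modulus is replaced by the sum of [|cRe|] and [|cIm|], which dominates it and is directly
    measurable. *)
Lemma smul_small xi (e : R) : L0K isC xi -> 0 < e ->
  exists2 del : R, 0 < del & forall x, N x < del -> N (smul xi x) < e.
Proof.
move=> Hxi e0; case: (Hxi) => mRe [mIm _].
have mC : L0R (fun w => `|cRe (xi w)| + `|cIm (xi w)|).
  by apply: measurable_funD; apply: measurableT_comp.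
have [del del0 H] := pnrm_mul_small mC e0.
exists del => // x; apply: H.
apply: filterS2 (nrm_smul x Hxi) (nrm_ge0 x) => w -> x0.
apply: ler_wpM2r => //; rewrite /cabs.
have h : 0 <= `|cRe (xi w)| + `|cIm (xi w)| by rewrite addr_ge0.
rewrite -(ger0_norm h) -sqrtr_sqr ler_wsqrtr//.
rewrite sqrrD !real_normK ?num_real//.
by rewrite -subr_ge0 [leRHS](_ : _ = `|cRe (xi w)| * `|cIm (xi w)| *+ 2)
  ?mulrn_wge0 ?mulr_ge0//; ring.
Qed.

(** Here the roles in [rho_mul_small] are exchanged: [nrm z] is the fixed random factor and the
    constant [c] is the small function. *)
Lemma pnrm_rscal_small z (e : R) : 0 < e -> exists2 del : R, 0 < del &
  forall c, `|c| < del -> N (c ** z) < e.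
Proof.
move=> e0; have [del del0 H] := rho_mul_small P (nrm_meas z) e0.
exists del => // c cdel; apply: (H _ (cst c)) => //.
- exact: measurable_cst.
- have := nrm_ge0 (c ** z); apply: filterS2 (nrm_rscal c z) => w E.
  by move=> /ger0_norm ->; rewrite E mulrC.
- exact: le_lt_trans (rho_cst_le P c) cdel.
Qed.

(** An a.s. bound survives limits in probability: the positive part of [nrm z - B] is dominated by
    [nrm (z - z')], so its [rho] is 0. *)
Lemma nrm_le_closed z B : L0R B ->
  (forall e : R, 0 < e -> exists2 z', N (z - z') < e &
     {ae P, forall w, nrm z' w <= B w}) ->
  {ae P, forall w, nrm z w <= B w}.
Proof.
move=> mB H; pose f w := Num.max (nrm z w - B w) 0.
have mf : L0R f.
  apply: measurable_maxr; last exact: measurable_cst.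
  by apply: measurable_funB => //; exact: nrm_meas.
suff f0 : rho P f = 0.
  apply: filterS (rho_eq0 mf f0) => w; rewrite /f => /eqP.
  by rewrite eq_maxr ?subr_le0//; case: leP => // /[swap] /eqP ->; rewrite subrr.
apply/eqP; rewrite eq_le rho_ge0 andbT leNgt; apply/negP => /H[z' zz' z'B].
suff : rho P f <= N (z - z') by rewrite leNgt zz'.
apply: le_rho => //.
apply: filterS3 z'B (nrmD (z - z') z') (nrm_ge0 (z - z')) => w a b c.
rewrite subrK in b; rewrite (ger0_norm c) ger0_norm /f ?le_max ?lexx ?orbT//.
by rewrite ge_max c andbT; lra.
Qed.

(** The threshold is lowered to [Num.min e 1] because Markov's inequality for the truncation needs a
    level of at most 1. *)
Lemma near_of_pnrm x y (e l : R) : 0 < e -> 0 < l ->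
  N (y - x) < Num.min e 1 * l -> el_near P nrm y x e l.
Proof.
move=> e0 l0 H; rewrite /el_near.
have := near_of_rho (nrm_meas (y - x)) _ _ H.
rewrite lt_min e0 ltr01 ge_min lexx orbT => /(_ erefl erefl) /lt_le_trans; apply.
have mlt c : measurable [set w | nrm (y - x) w < c].
  by apply: measurable_lt; exact: nrm_meas.
apply: le_measure; rewrite ?inE//.
by move=> w /=; rewrite lt_min => /andP[].
Qed.

Lemma pnrm_of_near x y (e l : R) : 0 < e -> el_near P nrm y x e l -> N (y - x) < e + l.
Proof. by move=> e0; apply: rho_le_near => //; exact: nrm_ge0. Qed.

Lemma el_cvgP {U : Type} (F : set_system U) (FF : Filter F) (g : U -> S) x :
  el_cvg P nrm F g x <->
  forall e : R, 0 < e -> \forall u \near F, N (g u - x) < e.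
Proof.
split=> [H e e0|H e l e0 l0].
  have h0 : 0 < e / 2 by rewrite divr_gt0.
  have := H _ _ h0 h0; apply: filterS => u /(pnrm_of_near h0).
  by rewrite -splitr.
have h0 : 0 < Num.min e 1 * l by rewrite mulr_gt0// lt_min e0 ltr01.
by have := H _ h0; apply: filterS => u; exact: near_of_pnrm.
Qed.

Lemma el_cvg_unique {U : Type} (F : set_system U) (FF : ProperFilter F)
    (g : U -> S) x y :
  el_cvg P nrm F g x -> el_cvg P nrm F g y -> x = y.
Proof.
move=> /el_cvgP gx /el_cvgP gy; apply/eqP; rewrite -subr_eq0; apply/eqP.
apply: pnrm_small0 => e e0; have h0 : 0 < e / 2 by rewrite divr_gt0.
have : \forall u \near F, N (x - y) < e.
  apply: filterS2 (gx _ h0) (gy _ h0) => u a b.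
  by rewrite (le_lt_trans (pnrm_triangle (g u) x y))// (splitr e) ltrD// pnrm_distC.
by case/filter_ex.
Qed.

Lemma el_cvg_right0P (g : R -> S) x :
  el_cvg P nrm (0 : R)^'+ g x <->
  forall e : R, 0 < e -> exists2 del : R, 0 < del &
    forall k, 0 < k -> k < del -> N (g k - x) < e.
Proof.
rewrite el_cvgP; split=> H e e0.
  have := H e e0; rewrite /at_right near_withinE => /nbhs_ballP[del /= del0 Hb].
  exists del => // k k0 kdel; apply: Hb => //.
  by rewrite /ball /= sub0r normrN gtr0_norm.
have [del del0 Hd] := H e e0.
near=> k; apply: Hd; near: k.
- exact: nbhs_right_gt.
- exact: nbhs_right_lt.
Unshelve. all: by end_near. Qed.
End RNModule.

(** * Random bounds and uniform continuity of orbits on compact intervals *)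

Section Semigroup.
Context {d : measure_display} {Omega : measurableType d} {R : realType}.
Context {P : probability Omega R} {isC : bool} {S : zmodType}.
Context {smul : (Omega -> Cx R) -> S -> S} {nrm : S -> Omega -> R}.
Context {T : R -> S -> S}.
Context (HS : is_RN_module P isC smul nrm).
Context (HT : is_C0_semigroup P isC smul nrm T).
Context (HB : as_bounded P nrm T).

Local Notation "c ** x" := (rscal smul c x) (at level 40).
Local Notation N := (pnrm P nrm).

(** The infimum [nu] is not a priori an admissible bound itself. The ratio of [nrm (f x)] to [nrm x]
    lies below every admissible [xi], hence below [nu]; where [nrm x] vanishes, one admissible [xi]
    already forces [nrm (f x)] to vanish. *)
Lemma opnorm_bound f nu x : is_opnorm P nrm f nu ->
  {ae P, forall w, nrm (f x) w <= nu w * nrm x w}.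
Proof.
case=> mnu [lb glb].
have [[xi [xi0 Hxi]]|none] := pselect (exists xi, L0plus P xi /\
    forall x, ae_le P (nrm (f x)) (fun w => xi w * nrm x w)); last first.
  (* an empty set has no infimum in [L0] *)
  have : ae_le P (fun w => nu w + 1) nu.
    apply: glb; first by apply: measurable_funD => //; exact: measurable_cst.
    by move=> g Eg; case: none; exists g.
  by apply: filterS => w /=; lra.
(* The power [-1] is the inverse on nonnegative reals, with value 0 at 0, and comes with a
   measurability lemma. *)
pose u w := nrm (f x) w * (nrm x w `^ (- 1)).
have mu : L0R u.
  apply: measurable_funM; first exact: (nrm_meas HS).
  apply: (measurableT_comp (measurable_powR _ )).
  exact: (nrm_meas HS).
have unu : ae_le P u nu.
  apply: glb => // g [g0 Hg]; have := nrm_ge0 HS x.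
  apply: filterS3 (Hg x) g0.2 => w gw g0' x0.
  rewrite /u powR_inv1//; move: x0; rewrite le_eqVlt => /orP[/eqP <-|x0].
    by rewrite invr0 mulr0.
  by rewrite ler_pdivrMr.
have := nrm_ge0 HS x.
apply: filterS3 unu (Hxi x) => w uw xw x0.
move: uw; rewrite /u powR_inv1//.
move: x0; rewrite le_eqVlt => /orP[/eqP x0|x0]; last by rewrite ler_pdivrMr.
by move: xw; rewrite -x0 !mulr0.
Qed.

Lemma T_D t x y : 0 <= t -> T t (x + y) = T t x + T t y.
Proof. by case: HT => H _ /H[]. Qed.

Lemma T_0 t : 0 <= t -> T t 0 = 0.
Proof. by move=> t0; apply: (addrI (T t 0)); rewrite -T_D// !addr0. Qed.

Lemma T_N t x : 0 <= t -> T t (- x) = - T t x.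
Proof.
by move=> t0; apply: (addrI (T t x)); rewrite -T_D// !subrr T_0.
Qed.

Lemma T_B t x y : 0 <= t -> T t (x - y) = T t x - T t y.
Proof. by move=> t0; rewrite T_D// T_N. Qed.

Lemma T_smul t xi x : 0 <= t -> L0K isC xi -> T t (smul xi x) = smul xi (T t x).
Proof. by case: HT => H _ /H[_ [+ _]]; exact. Qed.

Lemma T_rscal t c x : 0 <= t -> T t (c ** x) = c ** T t x.
Proof. by move=> t0; rewrite T_smul//; exact: L0K_cst. Qed.

Lemma T_sum t n (z : nat -> S) : 0 <= t ->
  T t (\sum_(i < n) z i) = \sum_(i < n) T t (z i).
Proof.
by move=> t0; apply: (big_morph (T t)) => [x y|]; rewrite ?T_D ?T_0.
Qed.

Lemma T0 x : T 0 x = x.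
Proof. by case: HT => _ []. Qed.

Lemma T_comp s t x : 0 <= s -> 0 <= t -> T s (T t x) = T (s + t) x.
Proof. by case: HT => _ [_ [+ _]]; exact. Qed.

(** The bound on [[0, L]] is iterated through the semigroup law: [n] steps of length [L] cost the
    power [M ^+ n]. Replacing the supremum by its maximum with 1 makes these powers increase with
    [n]. *)
Lemma T_bound (r : R) : exists M : Omega -> R,
  [/\ L0R M, forall w, 1 <= M w & forall t x, 0 <= t <= r ->
    {ae P, forall w, nrm (T t x) w <= M w * nrm x w}].
Proof.
case: HB => L [L0 [nu [Hnu [s [s0 [ms [sup _]]]]]]].
pose M w := Num.max (s w) 1.
have mM : L0R M by apply: measurable_maxr => //; exact: measurable_cst.
have M1 w : 1 <= M w by rewrite /M le_max lexx orbT.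
have base t x : 0 <= t <= L -> {ae P, forall w, nrm (T t x) w <= M w * nrm x w}.
  move=> tL; have st : ae_le P (nu t) s by apply: sup; exists t.
  apply: filterS3 st (opnorm_bound x (Hnu t tL)) (nrm_ge0 HS x) => w a b c.
  by rewrite (le_trans b)// ler_wpM2r// (le_trans a)// /M le_max lexx.
have H n t x : 0 <= t <= n%:R * L ->
    {ae P, forall w, nrm (T t x) w <= M w ^+ n * nrm x w}.
  elim: n t => [|n IH] t.
    rewrite mul0r -eq_le => /eqP <-; rewrite T0.
    by apply: aeW => w; rewrite expr0 mul1r.
  move=> /andP[t0 tn]; have [tL|Lt] := leP t L.
    have tL' : 0 <= t <= L by rewrite t0.
    apply: filterS2 (base t x tL') (nrm_ge0 HS x) => w H x0.
    rewrite (le_trans H)// ler_wpM2r// exprS ler_peMr ?(le_trans ler01)//.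
    by rewrite exprn_ege1.
  have L00 : 0 <= L <= L by rewrite lexx ltW.
  have tn' : 0 <= t - L <= n%:R * L.
    by move: tn; rewrite subr_ge0 (ltW Lt) lerBlDr -natr1 mulrDl mul1r.
  have -> : T t x = T L (T (t - L) x).
    by rewrite T_comp ?subr_ge0 ?ltW// addrC subrK.
  apply: filterS2 (base L (T (t - L) x) L00) (IH _ tn') => w a b.
  by rewrite (le_trans a)// exprS -mulrA ler_wpM2l// (le_trans ler01).
(* The exponent is a number of steps of length [L] sufficient to cover [[0, |r|]]. *)
exists (fun w => M w ^+ (Num.truncn (`|r| / L)).+1); split.
- exact: measurable_funX.
- by move=> w; rewrite exprn_ege1.
- move=> t x /andP[t0 tr]; apply: H; rewrite t0/=.
  have /andP[_ /ltW] := truncn_itv (divr_ge0 (normr_ge0 r) (ltW L0)).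
  by rewrite ler_pdivrMr//; apply: le_trans; rewrite (le_trans tr)// ler_norm.
Qed.

Lemma T_small (r e : R) : 0 < e -> exists2 del : R, 0 < del &
  forall t x, 0 <= t <= r -> N x < del -> N (T t x) < e.
Proof.
move=> e0; have [M [mM _ HM]] := T_bound r.
have [del del0 H] := pnrm_mul_small HS mM e0.
by exists del => // t x tr; apply: H; exact: HM.
Qed.

(** For [s <= t] the increment is [T s (T (t - s) y - y)], so right continuity at 0 and the
    equicontinuity [T_small] give uniform continuity on [[0, r]]. *)
Lemma T_cont y (r e : R) : 0 < e -> exists2 del : R, 0 < del &
  forall s t, 0 <= s <= r -> 0 <= t <= r -> `|t - s| < del ->
  N (T t y - T s y) < e.
Proof.
move=> e0; have [d1 d10 H1] := T_small r e0.
have /(el_cvg_right0P HS)/(_ _ d10)[del del0 H2] : el_cvg P nrm 0^'+ (fun t => T t y) y.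
  by case: HT => _ [_ []].
exists del => // s t; wlog st : s t / s <= t => [hw|].
  have [st|/ltW ts] := leP s t; first exact: hw.
  by rewrite distrC (pnrm_distC HS) => *; exact: hw.
move=> sr tr; move: st; rewrite le_eqVlt => /orP[/eqP <-|st].
  by rewrite !subrr (pnrm0 HS).
rewrite gtr0_norm ?subr_gt0// => tsdel.
have -> : T t y - T s y = T s (T (t - s) y - y).
  case/andP: sr => s0 _.
  by rewrite T_B// T_comp// ?subr_ge0 ?ltW// [s + _]addrC subrK.
by apply: H1 => //; apply: H2; rewrite ?subr_gt0.
Qed.

(** The increments share the a.s. bound twice [M * nrm y] and are uniformly small by [T_cont], so
    [pnrm_sum_small] applies however many terms there are. Every later comparison of sample points
    of an orbit rests on this. *)
Lemma T_osc y (r W e : R) : 0 < e -> exists2 del : R, 0 < del &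
  forall n (wt s t : nat -> R),
  (forall i, (i < n)%N -> 0 <= wt i) -> \sum_(i < n) wt i <= W ->
  (forall i, (i < n)%N -> 0 <= s i <= r) ->
  (forall i, (i < n)%N -> 0 <= t i <= r) ->
  (forall i, (i < n)%N -> `|t i - s i| < del) ->
  N (\sum_(i < n) wt i ** (T (t i) y - T (s i) y)) < e.
Proof.
move=> e0; have [M [mM _ HM]] := T_bound r.
have mC : L0R (fun w => M w * nrm y w + M w * nrm y w).
  by apply: measurable_funD; apply: measurable_funM => //; exact: (nrm_meas HS).
have [d1 d10 H1] := pnrm_sum_small HS W mC e0.
have [del del0 H2] := T_cont y r d10.
exists del => // n wt s t wt0 wtW sr tr st.
apply: (H1 n wt (fun i => T (t i) y - T (s i) y)) => // i ni.
  apply: filterS3 (nrmB HS (T (t i) y) (T (s i) y)) (HM _ y (tr i ni)) (HM _ y (sr i ni)).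
  by move=> w; lra.
by apply: H2; [exact: sr|exact: tr|exact: st].
Qed.
End Semigroup.

(** * Linearity of the generator, derivatives of orbits and the integral formula *)

Section Generator.
Context {d : measure_display} {Omega : measurableType d} {R : realType}.
Context {P : probability Omega R} {isC : bool} {S : zmodType}.
Context {smul : (Omega -> Cx R) -> S -> S} {nrm : S -> Omega -> R}.
Context {T : R -> S -> S} {D : set S} {A : S -> S}.
Context (HS : is_RN_module P isC smul nrm).
Context (HT : is_C0_semigroup P isC smul nrm T).
Context (HB : as_bounded P nrm T).
Context (HG : is_generator P smul nrm T D A).

Local Notation "c ** x" := (rscal smul c x) (at level 40).
Local Notation N := (pnrm P nrm).
Local Notation dq k x := (k^-1 ** (T k x - x)).

Lemma dq_lim x (e : R) : D x -> 0 < e -> exists2 del : R, 0 < del &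
  forall k, 0 < k -> k < del -> N (dq k x - A x) < e.
Proof. by case: HG => _ H Dx; have /(el_cvg_right0P HS) := H x Dx; exact. Qed.

(** By uniqueness of limits, a single limit computation gives both membership in [D] and the value
    of [A]. *)
Lemma gen_intro x y :
  (forall e : R, 0 < e -> exists2 del : R, 0 < del &
    forall k, 0 < k -> k < del -> N (dq k x - y) < e) -> D x /\ A x = y.
Proof.
move=> /(el_cvg_right0P HS) xy; case: HG => HD HA.
have Dx : D x by apply/HD; exists y.
by split => //; exact: (el_cvg_unique HS _ (HA x Dx) xy).
Qed.

Lemma gen_linear xi eta x y : L0K isC xi -> L0K isC eta -> D x -> D y ->
  D (smul xi x + smul eta y) /\
  A (smul xi x + smul eta y) = smul xi (A x) + smul eta (A y).
Proof.
move=> Hxi Heta Dx Dy; apply: gen_intro => e e0.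
have h0 : 0 < e / 2 by rewrite divr_gt0.
have [d1 d10 H1] := smul_small HS Hxi h0.
have [d2 d20 H2] := smul_small HS Heta h0.
have [e1 e10 L1] := dq_lim Dx d10.
have [e2 e20 L2] := dq_lim Dy d20.
exists (Num.min e1 e2); first by rewrite lt_min e10.
move=> k k0; rewrite lt_min => /andP[k1 k2].
have -> : dq k (smul xi x + smul eta y) - (smul xi (A x) + smul eta (A y)) =
    smul xi (dq k x - A x) + smul eta (dq k y - A y).
  rewrite [in RHS](smulBr HS)// [in X in _ = _ + X](smulBr HS)// addrACA -opprD.
  congr (_ - _); rewrite -!(rscal_smulC HS)// !(smulBr HS)// -(rscalDr HS).
  by rewrite (T_D HT) ?ltW// !(T_smul HT) ?ltW// opprD addrACA.
by rewrite (le_lt_trans (pnrmD HS _ _))// (splitr e) ltrD// ?H1 ?H2 ?L1 ?L2.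
Qed.

(** [T t] commutes with the difference quotients, and its continuity at 0 transports their limit. *)
Lemma gen_T x t : D x -> 0 <= t -> D (T t x) /\ A (T t x) = T t (A x).
Proof.
move=> Dx t0; apply: gen_intro => e e0.
have [d1 d10 H1] := T_small HS HT HB t e0.
have [e1 e10 L1] := dq_lim Dx d10.
exists e1 => // k k0 k1.
have -> : dq k (T t x) - T t (A x) = T t (dq k x - A x).
  rewrite (T_B HT)// (T_rscal HT)// (T_B HT)//.
  by rewrite !(T_comp HT)// ?ltW// [k + t]addrC.
by apply: H1; [rewrite t0 lexx|exact: L1].
Qed.

Lemma gen_derivative x t : D x -> 0 <= t ->
  el_has_derivative P smul nrm (fun u => T u x) t (T t (A x)).
Proof.
move=> Dx t0; apply/(el_cvgP HS) => e e0.
have h0 : 0 < e / 2 by rewrite divr_gt0.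
have [d1 d10 H1] := T_small HS HT HB t h0.
have [e1 e10 L1] := dq_lim Dx d10.
have [e2 e20 L2] := T_cont HS HT HB (A x) t h0.
rewrite !near_withinE; apply/nbhs_ballP.
exists (Num.min e1 e2) => /=; first by rewrite lt_min e10.
move=> h; rewrite /ball /= sub0r normrN lt_min => /andP[he1 he2] hn0 th0.
(* Both signs of [h] reduce to a forward quotient at 0 seen through [T s], with [s = t] for positive
   [h] and [s = t + h] for negative [h]. In the second case the base point moves, which costs the
   comparison of [T s (A x)] with [T t (A x)]. *)
suff [s [s0 st [tsh ->]]] : exists s, [/\ 0 <= s, s <= t &
    `|s - t| <= `|h| /\ h^-1 ** (T (t + h) x - T t x) = T s (dq `|h| x)].
  rewrite (le_lt_trans (pnrm_triangle HS (T s (A x)) _ _))// (splitr e) ltrD//.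
    rewrite -(T_B HT)// H1 ?s0// L1 ?normr_gt0//; exact/eqP.
  by apply: L2; rewrite ?s0 ?t0 ?lexx// (le_lt_trans tsh).
have [hp|hn] := ltP 0 h.
  exists t; split => //; rewrite subrr normr0 normr_ge0; split => //.
  rewrite gtr0_norm// (T_rscal HT)// (T_B HT)// (T_comp HT)//; exact: ltW.
exists (t + h); split => //; first by rewrite gerDl.
rewrite addrAC subrr add0r ler0_norm//; split => //.
rewrite (T_rscal HT)// (T_B HT)// (T_comp HT)// ?oppr_ge0//.
by rewrite addrK invrN (rscalNl HS) -(rscalN HS) opprB.
Qed.

Lemma nrm_sum_T n (wt t : nat -> R) v (M : Omega -> R) :
  (forall i, (i < n)%N -> 0 <= wt i) ->
  (forall i, (i < n)%N -> {ae P, forall w, nrm (T (t i) v) w <= M w * nrm v w}) ->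
  {ae P, forall w, nrm (\sum_(i < n) wt i ** T (t i) v) w
    <= (\sum_(i < n) wt i) * (M w * nrm v w)}.
Proof.
move=> wt0 HM.
have H : {ae P, forall w, forall i : 'I_n, nrm (T (t i) v) w <= M w * nrm v w}.
  by apply: filter_forall => i; exact: HM.
apply: filterS2 H (nrm_sum HS n wt (fun i => T (t i) v)) => w H /le_trans; apply.
by rewrite mulr_suml ler_sum// => i _; rewrite ger0_norm ?wt0// ler_wpM2l ?wt0.
Qed.

(* The difference quotients of an orbit converge only in probability; the
   equidistant telescoping sum turns their convergence into an a.s. bound. *)
Lemma gen_lipschitz x (r r0 : R) (M : Omega -> R) : D x -> L0R M ->
  (forall t y, 0 <= t <= r0 -> {ae P, forall w, nrm (T t y) w <= M w * nrm y w}) ->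
  0 < r -> r <= r0 ->
  {ae P, forall w, nrm (T r x - x) w <= r * (M w * nrm (A x) w)}.
Proof.
move=> Dx mM HM r_gt0 rr0; apply: (nrm_le_closed HS).
  apply: measurable_funM; first exact: measurable_cst.
  by apply: measurable_funM => //; exact: (nrm_meas HS).
move=> e e0.
have mC : L0R (fun w => r * M w).
  by apply: measurable_funM => //; exact: measurable_cst.
have [d1 d10 H1] := pnrm_mul_small HS mC e0.
have [e1 e10 L1] := dq_lim Dx d10.
(* The successor makes [n] strictly larger than [r / e1], so the step [h] is below [e1]. *)
pose n := (Num.truncn (r / e1)).+1; pose h := r / n%:R.
have n0 : 0 < n%:R :> R by rewrite ltr0n.
have h0 : 0 < h by rewrite divr_gt0.
have he1 : h < e1.
  have /andP[_] := truncn_itv (ltW (divr_gt0 r_gt0 e10)).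
  by rewrite -/n /h !ltr_pdivrMr// mulrC.
have nh : n%:R * h = r by rewrite /h mulrC divfK// gt_eqF.
have hn : \sum_(i < n) h = r by rewrite sumr_const card_ord -mulr_natl.
have ih i : (i < n)%N -> 0 <= i%:R * h <= r0.
  move=> ni; rewrite mulr_ge0 ?ler0n ?(ltW h0)//= (le_trans _ rr0)//.
  by rewrite -nh ler_wpM2r ?(ltW h0)// ler_nat ltnW.
have Mb v i : (i < n)%N ->
    {ae P, forall w, nrm (T (i%:R * h) v) w <= M w * nrm v w}.
  by move=> ni; apply: HM; exact: ih.
have h0' (i : nat) : (i < n)%N -> 0 <= h by move=> _; exact: ltW.
exists (\sum_(i < n) h ** T (i%:R * h) (A x)); last first.
  have := nrm_sum_T (wt := fun=> h) (t := fun i => i%:R * h) h0' (Mb (A x)).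
  by rewrite hn.
apply: (H1 _ (dq h x - A x)); last exact: L1.
have -> : T r x - x - \sum_(i < n) h ** T (i%:R * h) (A x) =
    \sum_(i < n) h ** T (i%:R * h) (dq h x - A x).
  have -> : T r x - x = \sum_(i < n) h ** T (i%:R * h) (dq h x).
    rewrite -(big_mkord xpredT (fun i => h ** T (i%:R * h) (dq h x))).
    rewrite (telescope_sumr_eq (fun i => T (i%:R * h) x))//.
      by rewrite nh mul0r (T0 HT).
    move=> i /andP[_ ni]; have /andP[ih0 _] := ih _ ni.
    rewrite (T_rscal HT)// (T_B HT)// (T_comp HT)// ?ltW//.
    rewrite (rscalA HS) divff ?gt_eqF// (rscal1 HS).
    by rewrite -[i.+1%:R]natr1 mulrDl mul1r.
  rewrite -sumrB; apply: eq_bigr => i _.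
  have /andP[ih0 _] := ih _ (ltn_ord i).
  by rewrite (T_B HT)// [RHS](rscalBr HS).
have := nrm_sum_T (wt := fun=> h) (t := fun i => i%:R * h) h0' (Mb (dq h x - A x)).
by rewrite hn; apply: filterS => w; rewrite mulrA.
Qed.

Lemma partition_itv (r : R) n s tau : tagged_partition 0 r n s tau ->
  forall i, (i <= n)%N -> 0 <= s i <= r.
Proof.
move=> [s0 [sn [sS _]]] i ni.
have mono a b : (a <= b)%N -> (b <= n)%N -> s a <= s b.
  elim: b => [|b IH]; first by rewrite leqn0 => /eqP ->.
  rewrite leq_eqVlt => /orP[/eqP ->//|ab bn].
  by rewrite (le_trans (IH ab (ltnW bn)))// ltW// sS.
by rewrite -{1}s0 -sn !mono.
Qed.

(** The increment [T r x - x] telescopes over the given partition into a left-endpoint sum in which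
    [A x] is replaced by the quotient over each subinterval. What remains is an oscillation error
    from the tags and an error from these quotients. *)
Lemma gen_integral x (r : R) : D x -> 0 < r ->
  el_riemann_integral P smul nrm (fun u => T u (A x)) 0 r (T r x - x).
Proof.
move=> Dx r0 e l e0 l0.
have eps0 : 0 < Num.min e 1 * l by rewrite mulr_gt0// lt_min e0 ltr01.
set eps := Num.min e 1 * l in eps0.
have h0 : 0 < eps / 2 by rewrite divr_gt0.
have [M [mM M1 HM]] := T_bound HS HT HB r.
have mMA : L0R (fun w => M w * nrm (A x) w).
  by apply: measurable_funM => //; exact: (nrm_meas HS).
(* This is the common bound for the second error: [gen_lipschitz] bounds the quotient by
   [M * nrm (A x)], subtracting [A x] adds [nrm (A x)], and applying [T (s i)] costs another factor
   [M]. *)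
have mC : L0R (fun w => M w * (M w * nrm (A x) w + nrm (A x) w)).
  apply: measurable_funM => //; apply: measurable_funD => //.
  exact: (nrm_meas HS).
have [d1 d10 H1] := T_osc HS HT HB (A x) r r h0.
have [d2 d20 H2] := pnrm_sum_small HS r mC h0.
have [d3 d30 H3] := T_small HS HT HB r d20.
have [d4 d40 H4] := dq_lim Dx d30.
exists (Num.min d1 d4); split; first by rewrite lt_min d10.
move=> n s tau Hp mesh; apply: (near_of_pnrm HS) => //; rewrite -/eps.
have sr := partition_itv Hp.
case: (Hp) => s0 [sn [sS stau]].
pose D_ i := s i.+1 - s i.
have D0 i : (i < n)%N -> 0 < D_ i by move=> ni; rewrite subr_gt0 sS.
have Dd i : (i < n)%N -> D_ i < d1 /\ D_ i < d4.
  by move=> /mesh; rewrite lt_min => /andP.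
have sumD : \sum_(i < n) D_ i = r.
  by rewrite -(big_mkord xpredT D_) telescope_sumr// s0 sn subr0.
have -> : riemann_sum smul (fun u => T u (A x)) n s tau - (T r x - x) =
    \sum_(i < n) D_ i ** (T (tau i) (A x) - T (s i) (A x)) -
    \sum_(i < n) D_ i ** T (s i) (dq (D_ i) x - A x).
  have -> : T r x - x = \sum_(i < n) D_ i ** T (s i) (dq (D_ i) x).
    rewrite -(big_mkord xpredT (fun i => D_ i ** T (s i) (dq (D_ i) x))).
    rewrite (telescope_sumr_eq (fun i => T (s i) x))//.
      by rewrite s0 sn (T0 HT).
    move=> i /andP[_ ni]; have /andP[si0 _] := sr _ (ltnW ni).
    rewrite (T_rscal HT)// (T_B HT)// (T_comp HT)// ?(ltW (D0 _ ni))//.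
    rewrite (rscalA HS) divff ?gt_eqF ?D0// (rscal1 HS).
    by rewrite /D_ [s i + _]addrC subrK.
  rewrite /riemann_sum -!sumrB; apply: eq_bigr => i _.
  have /andP[si0 _] := sr _ (ltnW (ltn_ord i)).
  rewrite -/(D_ i); set u := dq (D_ i) x.
  by rewrite (T_B HT)// !(rscalBr HS) opprB addrA addrNK.
rewrite (le_lt_trans (pnrmD HS _ _))// (splitr eps) ltrD//.
  apply: (H1 n D_ s tau) => [i ni|||i ni|i ni].
  - exact/ltW/D0.
  - by rewrite sumD.
  - by move=> i ni; exact/sr/ltnW.
  - have /andP[a b] := stau _ ni; have /andP[c _] := sr _ (ltnW ni).
    by have /andP[_ f] := sr _ ni; rewrite (le_trans c a) (le_trans b f).
  - have /andP[a b] := stau _ ni; have [c _] := Dd _ ni.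
    by rewrite ger0_norm ?subr_ge0// (le_lt_trans _ c)// lerD2r.
rewrite (pnrmN HS); apply: (H2 n D_ (fun i => T (s i) (dq (D_ i) x - A x))) => [i ni||i ni|i ni].
- exact/ltW/D0.
- by rewrite sumD.
- have Dr : D_ i <= r.
    have /andP[a _] := sr _ (ltnW ni); have /andP[_ b] := sr _ ni.
    by rewrite /D_; lra.
  (* The bound [M] was fixed for all of [[0, r]], so the same one serves every subinterval
     length. *)
  have lip := gen_lipschitz Dx mM HM (D0 _ ni) Dr.
  have dqb : {ae P, forall w, nrm (dq (D_ i) x - A x) w
                     <= M w * nrm (A x) w + nrm (A x) w}.
    have := nrmB HS (dq (D_ i) x) (A x).
    apply: filterS3 lip (nrm_rscal HS (D_ i)^-1 (T (D_ i) x - x)) => w a b c.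
    rewrite (le_trans c)// lerD2r b gtr0_norm ?invr_gt0 ?D0//.
    by rewrite mulrC ler_pdivrMr ?D0// mulrC.
  apply: filterS2 dqb (HM (s i) (dq (D_ i) x - A x) (sr _ (ltnW ni))) => w a b.
  by rewrite (le_trans b)// ler_wpM2l// (le_trans ler01).
- by apply: H3; [exact: (sr _ (ltnW ni))|apply: H4; [exact: D0|case: (Dd _ ni)]].
Qed.
End Generator.

(** * Averages of orbits and density of the domain *)

Section Density.
Context {d : measure_display} {Omega : measurableType d} {R : realType}.
Context {P : probability Omega R} {isC : bool} {S : zmodType}.
Context {smul : (Omega -> Cx R) -> S -> S} {nrm : S -> Omega -> R}.
Context {T : R -> S -> S} {D : set S} {A : S -> S}.
Context (HS : is_RN_module P isC smul nrm).
Context (HC : el_complete P nrm).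
Context (HT : is_C0_semigroup P isC smul nrm T).
Context (HB : as_bounded P nrm T).
Context (HG : is_generator P smul nrm T D A).

Local Notation "c ** x" := (rscal smul c x) (at level 40).
Local Notation N := (pnrm P nrm).
Local Notation dq k x := (k^-1 ** (T k x - x)).

(** A left-endpoint Riemann sum over [n] equal pieces of [[0, h]], already divided by [h], so that
    the weights have total mass 1 for positive [n]. *)
Definition orbit_avg (h : R) (x : S) (n : nat) : S :=
  \sum_(i < n) n%:R^-1 ** T (i%:R * (h / n%:R)) x.

(** Each value [i] of [j %/ m] occurs [m] times. This writes a coarse average over a finer grid, so
    that two averages can be compared term by term. *)
Lemma sum_block n m (F : nat -> S) : (0 < n)%N -> (0 < m)%N ->
  \sum_(j < n * m) (n * m)%:R^-1 ** F (j %/ m)%N = \sum_(i < n) n%:R^-1 ** F i.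
Proof.
move=> n0 m0.
rewrite -(big_mkord xpredT (fun j => (n * m)%:R^-1 ** F (j %/ m)%N)) big_nat_mul big_mkord.
apply: eq_bigr => i _.
rewrite (@eq_big_nat _ _ _ _ _ _ (fun=> (n * m)%:R^-1 ** F i)); last first.
  move=> j /andP[j1 j2]; congr (_ ** F _); apply/eqP.
  by rewrite eqn_leq leq_divRL// j1 andbT -ltnS ltn_divLR.
rewrite -(big_morph (fun a => a ** F i) (fun a b => rscalDl HS a b (F i)) (rscal0l HS (F i))).
congr (_ ** _); rewrite sumr_const_nat -mulnBl subSnn mul1n -[LHS]mulr_natr.
by rewrite natrM invfM -mulrA mulVf ?mulr1// pnatr_eq0 -lt0n.
Qed.

Lemma sum_inv n : (0 < n)%N -> \sum_(i < n) n%:R^-1 = 1 :> R.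
Proof.
by move=> n0; rewrite sumr_const card_ord -[LHS]mulr_natl divff// pnatr_eq0 -lt0n.
Qed.

Lemma orbit_avg_refine (h : R) x (e : R) : 0 < h -> 0 < e ->
  exists2 del : R, 0 < del & forall n m, (0 < n)%N -> (0 < m)%N -> h / n%:R < del ->
  N (orbit_avg h x (n * m) - orbit_avg h x n) < e.
Proof.
move=> h0 e0; have [del del0 H] := T_osc HS HT HB x h 1 e0.
exists del => // n m n0 m0 hn.
have nR : 0 < n%:R :> R by rewrite ltr0n.
have mR : 0 < m%:R :> R by rewrite ltr0n.
have nmR : 0 < (n * m)%:R :> R by rewrite ltr0n muln_gt0 n0.
rewrite /orbit_avg -(sum_block (fun i => T (i%:R * (h / n%:R)) x) n0 m0) -sumrB.
under eq_bigr do rewrite -(rscalBr HS).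
(* The fine point of index [j] exceeds the left end of its coarse block by the fraction
   [(j %% m) / m] of the coarse step. *)
have key (j : nat) : (j < n * m)%N ->
    [/\ 0 <= (j %/ m)%N%:R * (h / n%:R), j%:R * (h / (n * m)%:R) <= h,
     (j %/ m)%N%:R * (h / n%:R) <= j%:R * (h / (n * m)%:R) &
     j%:R * (h / (n * m)%:R) - (j %/ m)%N%:R * (h / n%:R) < h / n%:R].
  move=> jnm; split.
  - by rewrite mulr_ge0// divr_ge0// ltW.
  - by rewrite mulrCA ger_pMr// ler_pdivrMr// mul1r ler_nat ltnW.
  - rewrite [leLHS](_ : _ = ((j %/ m) * m)%N%:R * (h / (n * m)%:R)); last first.
      by rewrite !natrM; field; rewrite !gt_eqF.
    by rewrite ler_wpM2r ?divr_ge0 ?(ltW h0)// ler_nat leq_trunc_div.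
  - rewrite [X in X - _](_ : _ = ((j %/ m) * m + j %% m)%N%:R * (h / (n * m)%:R)); last first.
      by rewrite -divn_eq.
    rewrite [ltLHS](_ : _ = (j %% m)%N%:R / m%:R * (h / n%:R)); last first.
      by rewrite natrD !natrM; field; rewrite !gt_eqF.
    rewrite gtr_pMl ?divr_gt0// ltr_pdivrMr// mul1r ltr_nat ltn_mod//.
apply: (H (n * m)%N (fun=> (n * m)%:R^-1) (fun j => (j %/ m)%N%:R * (h / n%:R))
          (fun j => j%:R * (h / (n * m)%:R))) => [j _||j nj|j nj|j nj].
- by rewrite invr_ge0.
- by rewrite sum_inv// muln_gt0 n0.
- by have [a b c _] := key j nj; rewrite a (le_trans c b).
- by have [a b c _] := key j nj; rewrite (le_trans a c) b.
- have [a b c f] := key j nj; rewrite ger0_norm ?subr_ge0//.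
  exact: lt_trans hn.
Qed.

Lemma orbit_avg_cvg (h : R) x : 0 < h ->
  exists y, el_cvg P nrm \oo (fun n => orbit_avg h x n.+1) y.
Proof.
move=> h0; apply: HC => e l e0 l0.
have eps0 : 0 < Num.min e 1 * l by rewrite mulr_gt0// lt_min e0 ltr01.
set eps := Num.min e 1 * l in eps0.
have [del del0 H] := orbit_avg_refine x h0 (divr_gt0 eps0 (ltr0n _ 2)).
have small n : (Num.truncn (h / del) <= n)%N -> h / n.+1%:R < del.
  move=> nn; have /andP[_] := truncn_itv (ltW (divr_gt0 h0 del0)).
  rewrite !ltr_pdivrMr// => /lt_le_trans; apply.
  by rewrite mulrC ler_pM2l// ler_nat.
exists (Num.truncn (h / del)) => m n mm nn; apply: (near_of_pnrm HS) => //.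
(* Two averages are compared through their common refinement, whose number of pieces is the
   product. *)
rewrite -/eps (le_lt_trans (pnrm_triangle HS (orbit_avg h x (n.+1 * m.+1)) _ _))//.
rewrite (splitr eps) ltrD//; first by rewrite (pnrm_distC HS) H// small.
by rewrite mulnC H// small.
Qed.

(** Discrete form of $\int_k^{k+h}-\int_0^h=\int_h^{h+k}-\int_0^k$: both sides come from splitting a
    sum over [n + m] indices in two ways. *)
Lemma sum_shift n m (G : nat -> S) :
  \sum_(i < n) G (m + i)%N - \sum_(i < n) G i =
  \sum_(i < m) (G (n + i)%N - G i).
Proof.
rewrite sumrB; apply/eqP; rewrite subr_eq addrAC eq_sym subr_eq eq_sym.
rewrite [X in X == _]addrC [X in _ == X]addrC.
have E a b : \sum_(i < a) G i + \sum_(i < b) G (a + i)%N = \sum_(i < a + b) G i.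
  by rewrite big_split_ord.
by rewrite !E addnC.
Qed.

Lemma dq_small k (e : R) : 0 < k -> 0 < e -> exists2 del : R, 0 < del &
  forall v, N v < del -> N (dq k v) < e.
Proof.
move=> k0 e0; have [d1 d10 H1] := smul_small HS (L0K_cst k^-1) e0.
have h0 : 0 < d1 / 2 by rewrite divr_gt0.
have [d2 d20 H2] := T_small HS HT HB k h0.
exists (Num.min d2 (d1 / 2)); first by rewrite lt_min d20.
move=> v; rewrite lt_min => /andP[v1 v2]; apply: H1.
rewrite (le_lt_trans (pnrmD HS _ _))// (splitr d1) ltrD ?(pnrmN HS)//.
by apply: H2; rewrite // lexx ltW.
Qed.

(** Discrete form of $A\bigl(h^{-1}\int_0^h T(s)x\,ds\bigr)=h^{-1}(T(h)x-x)$, with [k] rounded down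
    to [m] grid steps. The three terms are the rounding error in the orbit, the oscillation of the
    orbit of [z] near 0, and the rounding error in the scalar factor. *)
Lemma dq_orbit_avg (h k : R) x n : 0 < h -> 0 < k -> (0 < n)%N ->
  let m := Num.truncn (k / (h / n%:R)) in let z := T h x - x in
  dq k (orbit_avg h x n) - h^-1 ** z =
    \sum_(i < n) (k^-1 / n%:R) **
      (T (k + i%:R * (h / n%:R)) x - T ((m + i)%N%:R * (h / n%:R)) x) +
    \sum_(i < m) (k^-1 / n%:R) ** (T (i%:R * (h / n%:R)) z - T 0 z) +
    (k^-1 / n%:R * m%:R - h^-1) ** z.
Proof.
move=> h0 k0 n0 m z; set del := h / n%:R; set a := k^-1 / n%:R.
have nR : 0 < n%:R :> R by rewrite ltr0n.
have del0 : 0 < del by rewrite divr_gt0.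
have id0 i : 0 <= i%:R * del by rewrite mulr_ge0// ltW.
have nd : n%:R * del = h by rewrite /del mulrC divfK// gt_eqF.
pose G i := a ** T (i%:R * del) x.
have -> : dq k (orbit_avg h x n) =
    \sum_(i < n) a ** T (k + i%:R * del) x - \sum_(i < n) G i.
  rewrite (rscalBr HS) /orbit_avg.
  rewrite (T_sum HT n (fun i => n%:R^-1 ** T (i%:R * del) x) (ltW k0)).
  rewrite (rscal_sumr HS k^-1 n (fun i => T k (n%:R^-1 ** T (i%:R * del) x))).
  rewrite (rscal_sumr HS k^-1 n (fun i => n%:R^-1 ** T (i%:R * del) x)).
  congr (_ - _); apply: eq_bigr => i _; last by rewrite (rscalA HS).
  by rewrite (T_rscal HT) ?id0 ?(ltW k0)// (T_comp HT) ?id0 ?(ltW k0)// (rscalA HS).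
have -> : \sum_(i < n) a ** (T (k + i%:R * del) x - T ((m + i)%N%:R * del) x) =
    \sum_(i < n) a ** T (k + i%:R * del) x - \sum_(i < n) G (m + i)%N.
  by rewrite -sumrB; apply: eq_bigr => i _; rewrite (rscalBr HS).
(* After [sum_shift], the difference at index [i] is [T (i%:R * del) z], because [n] grid steps make
   up exactly [h]. *)
have -> : \sum_(i < m) a ** (T (i%:R * del) z - T 0 z) =
    \sum_(i < n) G (m + i)%N - \sum_(i < n) G i - (a * m%:R) ** z.
  rewrite sum_shift (_ : (a * m%:R) ** z = \sum_(i < m) a ** z); last first.
    by rewrite -(rscal_suml HS m (fun=> a)) sumr_const card_ord mulr_natr.
  rewrite -sumrB; apply: eq_bigr => i _.
  rewrite (rscalBr HS) (T0 HT); congr (_ - _).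
  rewrite /G -(rscalBr HS) /z (T_B HT)// (T_comp HT) ?(ltW h0)//.
  by rewrite natrD mulrDl nd [h + _]addrC.
rewrite (rscalBl HS) !addrA subrK.
by rewrite addrNK.
Qed.

(* The limit of the averages is [h^-1 \int_0^h T(s) x ds]. *)
Lemma orbit_avg_lim_D (h : R) x y : 0 < h ->
  el_cvg P nrm \oo (fun n => orbit_avg h x n.+1) y -> D y.
Proof.
move=> h0 /(el_cvgP HS) Hy; set z := T h x - x.
suff [] : D y /\ A y = h^-1 ** z by [].
apply: (gen_intro HS HG) => e e0.
(* One quarter pays for replacing [y] by an average, the others for the three terms of
   [dq_orbit_avg]. Only the oscillation of the orbit of [z] limits [k]; the index [n] is chosen
   afterwards and may depend on [k]. *)
have q0 : 0 < e / 4 by rewrite divr_gt0.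
have [d1 d10 H1] := T_osc HS HT HB z 1 h^-1 q0.
exists (Num.min d1 1); first by rewrite lt_min d10 ltr01.
move=> k k0; rewrite lt_min => /andP[kd1 k1].
have [d2 d20 H2] := T_osc HS HT HB x (h + 1) k^-1 q0.
have [d3 d30 H3] := pnrm_rscal_small HS z q0.
have [d4 d40 H4] := dq_small k0 q0.
(* The bound [d2 / h] on the inverse of [n.+1] makes the grid step smaller than [d2]; the bound
   [d3 * k] makes the scalar rounding error smaller than [d3]. *)
have c0 : 0 < Num.min (d2 / h) (d3 * k).
  by rewrite lt_min divr_gt0// mulr_gt0.
have [n [n1 n2]] : exists n : nat, N (orbit_avg h x n.+1 - y) < d4 /\
    n.+1%:R^-1 < Num.min (d2 / h) (d3 * k).
  have [n nP] := filter_ex (filterI (Hy _ d40) (near_infty_natSinv_lt (PosNum c0))).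
  by exists n.
move: n2; rewrite lt_min => /andP[n2 n3].
have nR : 0 < n.+1%:R :> R by rewrite ltr0n.
set del := h / n.+1%:R; have del0 : 0 < del by rewrite divr_gt0.
pose m := Num.truncn (k / del).
have /andP[mk km] := truncn_itv (ltW (divr_gt0 k0 del0)).
rewrite -/m ler_pdivlMr// in mk; rewrite -/m ltr_pdivrMr// in km.
have nd : n.+1%:R * del = h by rewrite /del mulrC divfK// gt_eqF.
have dd2 : del < d2 by rewrite /del mulrC -ltr_pdivlMr.
have id0 i : 0 <= i%:R * del by rewrite mulr_ge0// ltW.
have a0 : 0 < k^-1 / n.+1%:R by rewrite divr_gt0 ?invr_gt0.
have aE : k^-1 / n.+1%:R = del / (h * k).
  by rewrite /del; field; rewrite !gt_eqF.
have inh i : (i < n.+1)%N -> i%:R * del <= h.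
  by move=> ni; rewrite -nd ler_wpM2r ?(ltW del0)// ler_nat ltnW.
rewrite (le_lt_trans (pnrm_triangle HS (dq k (orbit_avg h x n.+1)) _ _))//.
have -> : e = e / 4 + (e / 4 + e / 4 + e / 4) by field.
rewrite ltrD//.
  rewrite (_ : _ - _ = dq k (y - orbit_avg h x n.+1)); last first.
    rewrite -(rscalBr HS) (T_B HT) ?(ltW k0)//; congr (_ ** _).
    by rewrite !opprD !opprK addrACA.
  by apply: H4; rewrite (pnrm_distC HS).
rewrite (dq_orbit_avg x h0 k0 (ltn0Sn n)) -/del -/m -/z.
rewrite (le_lt_trans (pnrmD HS _ _))// ltrD//.
  rewrite (le_lt_trans (pnrmD HS _ _))// ltrD//.
    apply: (H2 n.+1 (fun=> k^-1 / n.+1%:R) (fun i => (m + i)%N%:R * del)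
      (fun i => k + i%:R * del)) => [i _||i ni|i ni|i ni].
    - exact: ltW.
    - by rewrite -mulr_sumr (sum_inv (ltn0Sn n)) mulr1.
    - rewrite id0 natrD mulrDl; have := inh _ ni; lra.
    - have := inh _ ni; have := id0 i; lra.
    - by rewrite natrD mulrDl ger0_norm; move: km; rewrite -natr1 mulrDl; lra.
  apply: (H1 m (fun=> k^-1 / n.+1%:R) (fun=> 0) (fun i => i%:R * del)) => [i _||i _|i mi|i mi].
  - exact: ltW.
  - rewrite sumr_const card_ord -[leLHS]mulr_natr aE.
    rewrite [leLHS](_ : _ = (m%:R * del) / k / h); last by field; rewrite !gt_eqF.
    by rewrite ler_piMl ?invr_ge0 ?(ltW h0)// ler_pdivrMr// mul1r.
  - by rewrite lexx ler01.
  - rewrite id0 /= (le_trans _ (ltW k1))// (le_trans _ mk)//.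
    by rewrite ler_wpM2r ?(ltW del0)// ler_nat ltnW.
  - rewrite subr0 ger0_norm// (le_lt_trans _ kd1)// (le_trans _ mk)//.
    by rewrite ler_wpM2r ?(ltW del0)// ler_nat ltnW.
apply: H3.
rewrite aE [X in `|X|](_ : _ = - ((k - m%:R * del) / (h * k))); last first.
  by field; rewrite !gt_eqF.
rewrite normrN ger0_norm ?divr_ge0 ?subr_ge0// ?mulr_ge0 ?ltW//.
rewrite ltr_pdivrMr ?mulr_gt0// (lt_trans (y := del))//.
  by move: km; rewrite -natr1 mulrDl mul1r; lra.
by rewrite /del mulrCA ltr_pM2l.
Qed.

(** For small [h] the orbit of [x] barely moves on [[0, h]], so all its averages, and hence their
    limit in [D], stay close to [x]. *)
Lemma gen_dense : el_dense P nrm D.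
Proof.
move=> x e l e0 l0.
have eps0 : 0 < Num.min e 1 * l by rewrite mulr_gt0// lt_min e0 ltr01.
set eps := Num.min e 1 * l in eps0.
have q0 : 0 < eps / 2 by rewrite divr_gt0.
have [del del0 H] := T_osc HS HT HB x 1 1 q0.
pose h := Num.min (del / 2) 1.
have h0 : 0 < h by rewrite lt_min divr_gt0// ltr01.
have hdel : h < del by rewrite gt_min; apply/orP; left; lra.
have h1 : h <= 1 by rewrite ge_min lexx orbT.
have [y Hy] := orbit_avg_cvg x h0.
exists y; split; first exact: orbit_avg_lim_D Hy.
apply: (near_of_pnrm HS) => //; rewrite -/eps.
have /(el_cvgP HS)/(_ _ q0)/filter_ex[n Hn] := Hy.
rewrite (le_lt_trans (pnrm_triangle HS (orbit_avg h x n.+1) _ _))// (splitr eps) ltrD//.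
  by rewrite (pnrm_distC HS).
have -> : orbit_avg h x n.+1 - x =
    \sum_(i < n.+1) n.+1%:R^-1 ** (T (i%:R * (h / n.+1%:R)) x - T 0 x).
  under eq_bigr do rewrite (rscalBr HS).
  rewrite sumrB; congr (_ - _).
  by rewrite -(rscal_suml HS n.+1 (fun=> n.+1%:R^-1)) sum_inv// (rscal1 HS) (T0 HT).
have ih i : (i < n.+1)%N -> 0 <= i%:R * (h / n.+1%:R) <= h.
  move=> ni; rewrite mulr_ge0 ?divr_ge0 ?(ltW h0)//= mulrCA ger_pMr//.
  by rewrite ler_pdivrMr ?ltr0n// mul1r ler_nat ltnW.
apply: (H n.+1 (fun=> n.+1%:R^-1) (fun=> 0) (fun i => i%:R * (h / n.+1%:R)))
  => [i _||i _|i ni|i ni].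
- by rewrite invr_ge0.
- by rewrite sum_inv.
- by rewrite lexx ler01.
- by have /andP[-> /le_trans] := ih _ ni; exact.
- have /andP[a b] := ih _ ni; rewrite subr0 ger0_norm//.
  exact: le_lt_trans hdel.
Qed.
End Density.

Theorem theorem3p9 (d : measure_display) (Omega : measurableType d) (R : realType)
  (P : probability Omega R) (isC : bool) (S : zmodType)
  (smul : (Omega -> Cx R) -> S -> S) (nrm : S -> Omega -> R)
  (T : R -> S -> S) (D : set S) (A : S -> S) :
  is_RN_module P isC smul nrm ->
  el_complete P nrm ->
  is_C0_semigroup P isC smul nrm T ->
  as_bounded P nrm T ->
  is_generator P smul nrm T D A ->
  (* A is a densely defined module homomorphism *)
  (el_dense P nrm D /\
   (forall xi eta x y, L0K isC xi -> L0K isC eta -> D x -> D y ->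
      D (smul xi x + smul eta y) /\
      A (smul xi x + smul eta y) = smul xi (A x) + smul eta (A y))) /\
  (* (a) *)
  (forall x t, D x -> 0 <= t ->
     D (T t x) /\ A (T t x) = T t (A x) /\
     el_has_derivative P smul nrm (fun u => T u x) t (A (T t x))) /\
  (* (b) *)
  (forall x (r : R), D x -> 0 < r ->
     el_riemann_integral P smul nrm (fun u => T u (A x)) 0 r (T r x - x) /\
     el_riemann_integral P smul nrm (fun u => A (T u x)) 0 r (T r x - x)).
Proof.
move=> HS HC HT HB HG; split; [|split].
- split; first exact: gen_dense HS HC HT HB HG.
  by move=> *; exact: (gen_linear HS HT HG).
- move=> x t Dx t0; have [DT AT] := gen_T HS HT HB HG Dx t0.
  by split=> //; split=> //; rewrite AT; exact: (gen_derivative HS HT HB HG).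
move=> x r Dx r0; have I1 := gen_integral HS HT HB HG Dx r0.
(* Tags are nonnegative, so [A (T u x)] and [T u (A x)] agree at each of them and both integrands
   have the same Riemann sums. *)
split=> // e l e0 l0; have [del [del0 H]] := I1 e l e0 l0.
exists del; split=> // n s tau Hp mesh.
have := H n s tau Hp mesh; congr el_near; apply: eq_bigr => i _.
have /andP[si0 _] := partition_itv Hp (ltnW (ltn_ord i)).
case: Hp => _ [_ [_ /(_ i (ltn_ord i)) /andP[si _]]].
by have [_ ->] := gen_T HS HT HB HG Dx (le_trans si0 si).
Qed.
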